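(* Let $A\in\mathbb{R}^{n\times n}$, $\tilde u\in\mathbb{R}^n$, $t_k\ge 0$, $\Delta t_k>0$, $t_{k+1}=t_k+\Delta t_k$, $\tau_k=[t_k,t_{k+1}]$, let $\eta_k$ be a positive integer, and let $\mathcal{H}(t_k)=\langle c_h,G_h\rangle_Z\subset\mathbb{R}^n$ with $G_h\in\mathbb{R}^{n\times\gamma_h}$. Let $\mathcal{H}(t_{k+1})=e^{A\Delta t_k}\mathcal{H}(t_k)+A^{-1}(e^{A\Delta t_k}-I_n)\tilde u$. Then the Hausdorff distance between the exact time-interval solution of the affine dynamics $$\mathcal{H}(\tau_k)=\big\{e^{A(t-t_k)}x(t_k)+A^{-1}(e^{A(t-t_k)}-I_n)\tilde u\ \big|\ t\in\tau_k,\ x(t_k)\in\mathcal{H}(t_k)\big\}$$ and the outer-approximation $$\widehat{\mathcal{H}}(\tau_k)=\operatorname{comb}\big(\mathcal{H}(t_k),\mathcal{H}(t_{k+1})\big)\oplus\mathcal{C},\qquad \mathcal{C}=\boldsymbol{\mathcal{F}}(\Delta t_k,\eta_k)\,\mathcal{H}(t_k)\oplus\boldsymbol{\mathcal{G}}(\Delta t_k,\eta_k)\,\tilde u,$$ is bounded by $$d_H\big(\mathcal{H}(\tau_k),\widehat{\mathcal{H}}(\tau_k)\big)\le\Delta\varepsilon^{\mathrm h}_k(\Delta t_k,\eta_k):=2\operatorname{err}(\mathcal{C})+\sqrt{\gamma_h}\,\big\|G_h^{(-)}\big\|_2,\qquad G_h^{(-)}=(e^{A\Delta t_k}-I_n)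G_h.$$
   Context: A zonotope is $\langle c,G\rangle_Z=\{c+\sum_{i=1}^{\gamma}G_{(\cdot,i)}\alpha_i:\alpha_i\in[-1,1]\}$. $\oplus$ is the Minkowski sum. $d_H$ is the Hausdorff distance with respect to the Euclidean norm; $\|\cdot\|_2$ of a matrix is the spectral norm. $\operatorname{box}(\mathcal{S})$ is the tightest axis-aligned box containing $\mathcal{S}$, $\operatorname{rad}(\mathcal{S})$ the radius of the smallest ball centered at the origin containing $\mathcal{S}$, and $\operatorname{err}(\mathcal{S}):=\operatorname{rad}(\operatorname{box}(\mathcal{S}))$. Here $\operatorname{comb}$ denotes the zonotope enclosure of the linear combination; for two zonotopes with the same number of generators, $\operatorname{comb}(\langle c_1,G_1\rangle_Z,\langle c_2,G_2\rangle_Z)=\langle\frac12(c_1+c_2),[\frac12(c_1-c_2)\ \ \frac12(G_1+G_2)\ \ \frac12(G_1-G_2)]\rangle_Z$. $A^{-1}(e^{As}-I_n)$ is understood as the power series $\sum_{i\ge0}A^is^{i+1}/(i+1)!$ if $A$ is singular. Interval matrices $[\underline M,\overline M]=\{M:\underline M\le M\le\overline M\}$ (entrywise) are added and scaled by interval arithmetic. With $|A|$ the entrywise absolute value: $E(\Delta t,\eta)=e^{|A|\Delta t}-\sum_{i=0}^{\eta}\frac{(|A|\Delta t)^i}{i!}$, $\boldsymbol{\mathcal{E}}(\Delta t,\eta)=[-E(\Delta t,\eta),E(\Delta t,\eta)]$, $\mathcal{I}_i(\Delta t)=[(i^{-i/(i-1)}-i^{-1/(i-1)})\Delta t^i,0]$,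 $\boldsymbol{\mathcal{F}}(\Delta t,\eta)=\bigoplus_{i=2}^{\eta}\mathcal{I}_i(\Delta t)\frac{A^i}{i!}\oplus\boldsymbol{\mathcal{E}}(\Delta t,\eta)$, $\boldsymbol{\mathcal{G}}(\Delta t,\eta)=\bigoplus_{i=2}^{\eta+1}\mathcal{I}_i(\Delta t)\frac{A^{i-1}}{i!}\oplus\boldsymbol{\mathcal{E}}(\Delta t,\eta)\Delta t$. The product of an interval matrix $[M_c-M_r,M_c+M_r]$ with a zonotope $\langle c,G\rangle_Z$ (a vector being a zonotope without generators) is evaluated by the outer-approximation $\langle M_cc,[M_cG\ \ \operatorname{diag}(M_r(|c|+\sum_j|G_{(\cdot,j)}|))]\rangle_Z$. *)

(* Defs.v *)
From HB Require Import structures.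
From mathcomp Require Import all_boot all_order all_algebra.
From mathcomp Require Import all_classical all_reals all_analysis.

Set Implicit Arguments.
Unset Strict Implicit.
Unset Printing Implicit Defensive.

Import Order.TTheory GRing.Theory Num.Theory.
Import numFieldNormedType.Exports.

Local Open Scope classical_set_scope.
Local Open Scope ring_scope.

Section Sets.
Variables (R : realType) (n : nat).
Implicit Types (S T : set 'cV[R]_n) (l u x y : 'cV[R]_n).

(* `|x| on matrices is the library's max norm, hence a separate Euclidean one. *)
Definition enorm x : R := Num.sqrt (\sum_(i < n) x i 0 ^+ 2).

Definition minkowski_sum S T : set 'cV[R]_n := [set x + y | x in S & y in T].

(* Extended-real valued, so that unbounded sets get the distance +oo. *)
Definition hausdorff_dist S T : \bar R :=
  maxe (ereal_sup [set ereal_inf [set (enorm (x - y))%:E | y in T] | x in S])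
       (ereal_sup [set ereal_inf [set (enorm (x - y))%:E | x in S] | y in T]).

Definition axis_box l u : set 'cV[R]_n :=
  [set x | forall i, l i 0 <= x i 0 <= u i 0].

(* The tightest box containing S is the intersection of all boxes containing
   it; this is setT when there is none. *)
Definition box S : set 'cV[R]_n :=
  [set x | forall l u, S `<=` axis_box l u -> axis_box l u x].

Definition rad S : R :=
  inf [set r | 0 <= r /\ S `<=` [set x | enorm x <= r]].

Definition err S : R := rad (box S).

End Sets.

Definition spectral_norm (R : realType) (m n : nat) (M : 'M[R]_(m, n)) : R :=
  sup [set enorm (M *m x) | x in [set x : 'cV[R]_n | enorm x <= 1]].

(* A zonotope is kept as a center and generators: comb and the product by an
   interval matrix depend on this representation and not only on the set. *)
Record zonotope (R : realType) (n g : nat) := Zonotope {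
  zcenter : 'cV[R]_n;
  zgen : 'M[R]_(n, g)
}.

Section Zonotopes.
Variables (R : realType) (n : nat).

Definition zset (g : nat) (Z : zonotope R n g) : set 'cV[R]_n :=
  [set zcenter Z + \sum_(i < g) a i *: col i (zgen Z) |
     a in [set a : 'I_g -> R | forall i, -1 <= a i <= 1]].

Definition zvec (v : 'cV[R]_n) : zonotope R n 0 := Zonotope v 0.

Definition zaffine (g : nat) (M : 'M[R]_n) (v : 'cV[R]_n)
    (Z : zonotope R n g) : zonotope R n g :=
  Zonotope (M *m zcenter Z + v) (M *m zgen Z).

Definition comb (g : nat) (Z1 Z2 : zonotope R n g) : zonotope R n (1 + g + g) :=
  Zonotope (2^-1 *: (zcenter Z1 + zcenter Z2))
    (row_mx (row_mx (2^-1 *: (zcenter Z1 - zcenter Z2))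
                    (2^-1 *: (zgen Z1 + zgen Z2)))
            (2^-1 *: (zgen Z1 - zgen Z2))).

End Zonotopes.

Section MatrixFunctions.
Variables (R : realType) (n : nat).
Implicit Types A : 'M[R]_n.

Definition absmx (m p : nat) (M : 'M[R]_(m, p)) : 'M[R]_(m, p) :=
  map_mx Num.norm M.

Definition expmx A : 'M[R]_n :=
  limn (series (fun i : nat => i`!%:R^-1 *: A ^+ i)).

(* A^-1 (e^{As} - I), read as its power series when A is singular. *)
Definition inv_expmx A (s : R) : 'M[R]_n :=
  if A \in unitmx then invmx A *m (expmx (s *: A) - 1%:M)
  else limn (series (fun i : nat => (s ^+ i.+1 / i.+1`!%:R) *: A ^+ i)).

End MatrixFunctions.

(* An interval matrix [lo, hi] is the pair (lo, hi). Interval addition is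
   endpointwise, i.e. the addition of the product of the two matrix spaces. *)
Definition imatrix (R : realType) (n : nat) : Type := ('M[R]_n * 'M[R]_n)%type.

Section IntervalMatrices.
Variables (R : realType) (n : nat).

Definition interval_scale_mx (a : R * R) (M : 'M[R]_n) : imatrix R n :=
  (\matrix_(i, j) Num.min (a.1 * M i j) (a.2 * M i j),
   \matrix_(i, j) Num.max (a.1 * M i j) (a.2 * M i j)).

Definition imatrix_scale (M : imatrix R n) (s : R) : imatrix R n :=
  (\matrix_(i, j) Num.min (M.1 i j * s) (M.2 i j * s),
   \matrix_(i, j) Num.max (M.1 i j * s) (M.2 i j * s)).

Definition imatrix_center (M : imatrix R n) : 'M[R]_n := 2^-1 *: (M.1 + M.2).
Definition imatrix_radius (M : imatrix R n) : 'M[R]_n := 2^-1 *: (M.2 - M.1).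

Definition imatrix_zonotope (g : nat) (M : imatrix R n) (Z : zonotope R n g) :
    zonotope R n (g + n) :=
  Zonotope (imatrix_center M *m zcenter Z)
    (row_mx (imatrix_center M *m zgen Z)
       (diag_mx (imatrix_radius M *m
         (absmx (zcenter Z) + \sum_(j < g) absmx (col j (zgen Z))))^T)).

Variable A : 'M[R]_n.

Definition rem_bound (dt : R) (eta : nat) : 'M[R]_n :=
  expmx (dt *: absmx A) - \sum_(0 <= i < eta.+1) i`!%:R^-1 *: (dt *: absmx A) ^+ i.

Definition imatrix_E (dt : R) (eta : nat) : imatrix R n :=
  (- rem_bound dt eta, rem_bound dt eta).

Definition interval_I (i : nat) (dt : R) : R * R :=
  ((i%:R `^ (- (i%:R / (i%:R - 1))) - i%:R `^ (- (1 / (i%:R - 1)))) * dt ^+ i, 0).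

Definition imatrix_F (dt : R) (eta : nat) : imatrix R n :=
  \sum_(2 <= i < eta.+1) interval_scale_mx (interval_I i dt) (i`!%:R^-1 *: A ^+ i)
  + imatrix_E dt eta.

Definition imatrix_G (dt : R) (eta : nat) : imatrix R n :=
  \sum_(2 <= i < eta.+2) interval_scale_mx (interval_I i dt) (i`!%:R^-1 *: A ^+ i.-1)
  + imatrix_scale (imatrix_E dt eta) dt.

End IntervalMatrices.

Section Reachability.
Variables (R : realType) (n g : nat) (A : 'M[R]_n) (u : 'cV[R]_n).
Implicit Types H : zonotope R n g.

Definition next_step (dt : R) H : zonotope R n g :=
  zaffine (expmx (dt *: A)) (inv_expmx A dt *m u) H.

Definition exact_solution (tk tk1 : R) H : set 'cV[R]_n :=
  [set expmx ((t - tk) *: A) *m x + inv_expmx A (t - tk) *m u |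
     t in `[tk, tk1] & x in zset H].

Definition curvature (dt : R) (eta : nat) H : set 'cV[R]_n :=
  minkowski_sum (zset (imatrix_zonotope (imatrix_F A dt eta) H))
                (zset (imatrix_zonotope (imatrix_G A dt eta) (zvec u))).

Definition outer_approx (dt : R) (eta : nat) H : set 'cV[R]_n :=
  minkowski_sum (zset (comb H (next_step dt H))) (curvature dt eta H).

Definition error_bound (dt : R) (eta : nat) H : R :=
  2 * err (curvature dt eta H)
  + Num.sqrt g%:R * spectral_norm ((expmx (dt *: A) - 1%:M) *m zgen H).

End Reachability.

(* Main.v *)
Require Import Defs.
From mathcomp Require Import all_boot all_order all_algebra.
From mathcomp Require Import all_classical all_reals all_analysis.
From mathcomp Require Import ring lra.

(** Along the trajectory issued from [x0], compare the exact point at time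
    [l * dt] past [tk], for [l] in [0, 1], with the chord point
    [(1 - l) x0 + l x1], where [x1] is the trajectory at [dt].

    The difference, the curvature defect, is a power series in [A] whose
    coefficients are [(l^i - l) dt^i / i!], applied to [x0], plus a similar
    series applied to [u]. Convexity puts [l^i - l] between its minimum, which is
    the left end of the interval [I_i], and 0; the terms beyond the truncation
    order are dominated by the tail of [e^{|A| dt}]. So the defect is an element
    of the curvature set [C] ([flow_defect_curvature]).

    A point of [comb] has three blocks of coefficients: a scalar, which fixes
    [l]; [a], which fixes [x0 = c + G a]; and [b]. It differs from the chord
    point for [l] and [a] by [G' w], where [G' = (e^{A dt} - I) G] and
    [w = (a - b) / 2 - l a] ([comb_point]). This yields both halves of the
    Hausdorff distance:
    - given an exact point, choosing [b = (1 - 2 l) a] makes [w] vanish, so the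
      chord point is in [comb] and the exact point is in the outer
      approximation;
    - given [y] in the outer approximation, the exact point with the same [l]
      and [a] differs from [y] by two vectors of [C], each of norm at most
      [err C], and by [G' w], of norm at most [sqrt gamma] times the spectral
      norm of [G'] because the entries of [w] are in [-1, 1]. *)

Set Implicit Arguments.
Unset Strict Implicit.
Unset Printing Implicit Defensive.

Import Order.TTheory GRing.Theory Num.Theory.
Import numFieldNormedType.Exports.

(** * Euclidean norm, Hausdorff distance and radius *)

Section EuclideanNorm.
Local Open Scope classical_set_scope.
Local Open Scope ring_scope.
Context (R : realType).

Lemma enorm_ge0 n (x : 'cV[R]_n) : 0 <= enorm x.
Proof. exact: sqrtr_ge0. Qed.

Lemma sqr_enorm n (x : 'cV[R]_n) : enorm x ^+ 2 = \sum_(i < n) x i 0 ^+ 2.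
Proof. by rewrite sqr_sqrtr// sumr_ge0// => i _; exact: sqr_ge0. Qed.

Lemma enormZ n (a : R) (x : 'cV[R]_n) : enorm (a *: x) = `|a| * enorm x.
Proof.
rewrite /enorm -sqrtr_sqr -sqrtrM ?sqr_ge0// mulr_sumr.
by congr Num.sqrt; apply: eq_bigr => i _; rewrite mxE exprMn.
Qed.

Lemma enorm0 n : enorm (0 : 'cV[R]_n) = 0.
Proof. by rewrite -(scale0r 0) enormZ normr0 mul0r. Qed.

Lemma enormN n (x : 'cV[R]_n) : enorm (- x) = enorm x.
Proof. by rewrite -scaleN1r enormZ normrN1 mul1r. Qed.

Lemma enorm_eq0 n (x : 'cV[R]_n) : enorm x = 0 -> x = 0.
Proof.
move=> x0; have := sqr_enorm x; rewrite x0 expr0n/= => /esym.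
move/psumr_eq0P => /(_ (fun i _ => sqr_ge0 _)) xi0.
apply/colP => i; rewrite mxE; apply/eqP; rewrite -sqrf_eq0; apply/eqP.
exact: xi0.
Qed.

Lemma ler_enorm n (x b : 'cV[R]_n) :
  (forall i, `|x i 0| <= b i 0) -> enorm x <= enorm b.
Proof.
move=> xb; rewrite ler_wsqrtr// ler_sum// => i _.
by rewrite -real_normK ?num_real// lerXn2r// ?nnegrE// (le_trans _ (xb i)).
Qed.

(** Cauchy-Schwarz, from the expansion of the sum of the squares
    [(|y| x_i - |x| y_i)^2]. *)
Lemma enorm_dot_le n (x y : 'cV[R]_n) :
  \sum_(i < n) x i 0 * y i 0 <= enorm x * enorm y.
Proof.
have [/enorm_eq0 x0|x0] := eqVneq (enorm x) 0.
  by rewrite x0 enorm0 mul0r big1// => i _; rewrite mxE mul0r.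
have [/enorm_eq0 y0|y0] := eqVneq (enorm y) 0.
  by rewrite y0 enorm0 mulr0 big1// => i _; rewrite mxE mulr0.
have xy_gt0 : 0 < enorm x * enorm y.
  by rewrite mulr_gt0// lt_neqAle eq_sym ?x0 ?y0 enorm_ge0.
have : 0 <= \sum_(i < n) (enorm y * x i 0 - enorm x * y i 0) ^+ 2.
  by rewrite sumr_ge0// => i _; exact: sqr_ge0.
under eq_bigr => i _.
  rewrite (_ : _ ^+ 2 = enorm y ^+ 2 * x i 0 ^+ 2 + enorm x ^+ 2 * y i 0 ^+ 2
    - (2 * (enorm x * enorm y)) * (x i 0 * y i 0)); last by ring.
  over.
rewrite sumrB big_split/= -!mulr_sumr -!sqr_enorm => H.
rewrite -(ler_pM2l xy_gt0); nra.
Qed.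

Lemma ler_enormD n (x y : 'cV[R]_n) : enorm (x + y) <= enorm x + enorm y.
Proof.
rewrite -(@ler_pXn2r _ 2)// ?nnegrE ?addr_ge0 ?enorm_ge0//.
rewrite sqr_enorm sqrrD !sqr_enorm.
under eq_bigr do rewrite mxE sqrrD.
by rewrite !big_split/= lerD2r lerD2l mulr2n lerD// enorm_dot_le.
Qed.

Lemma hausdorff_dist_le n (S T : set 'cV[R]_n) (b : R) :
  (forall x, S x -> exists2 y, T y & enorm (x - y) <= b) ->
  (forall y, T y -> exists2 x, S x & enorm (x - y) <= b) ->
  (hausdorff_dist S T <= b%:E)%E.
Proof.
move=> ST TS; rewrite /hausdorff_dist ge_max; apply/andP; split.
  apply: ge_ereal_sup => _ [x /ST[y Ty xy] <-].
  by apply: le_trans (_ : (enorm (x - y))%:E <= _)%E;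
    [apply: ereal_inf_lbound; exists y|rewrite lee_fin].
apply: ge_ereal_sup => _ [y /TS[x Sx xy] <-].
by apply: le_trans (_ : (enorm (x - y))%:E <= _)%E;
  [apply: ereal_inf_lbound; exists x|rewrite lee_fin].
Qed.

(** [err] is a real infimum: on an unbounded set it is the infimum of the empty
    set, namely 0, so a bounding box [l], [u] has to be exhibited first. *)
Lemma enorm_le_err n (S : set 'cV[R]_n) (l u x : 'cV[R]_n) :
  S `<=` axis_box l u -> S x -> enorm x <= err S.
Proof.
move=> Slu Sx; apply: lb_le_inf; last first.
  by move=> r [_]; apply => l' u' Slu'; exact: Slu'.
exists (enorm (\col_i (`|l i 0| + `|u i 0|))); split; first exact: enorm_ge0.
move=> y /(_ _ _ Slu) yb; apply: ler_enorm => i; rewrite mxE.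
have /andP[ly yu] := yb i.
rewrite ler_norml; apply/andP; split.
  by have := ler_norm (- l i 0); rewrite normrN; have := normr_ge0 (u i 0); lra.
by have := ler_norm (u i 0); have := normr_ge0 (l i 0); lra.
Qed.

Lemma spectral_norm_has_ubound m n (M : 'M[R]_(m, n)) :
  has_ubound [set enorm (M *m x) | x in [set x : 'cV[R]_n | enorm x <= 1]].
Proof.
exists (enorm (absmx M *m const_mx 1)) => _ [y y1 <-].
apply: ler_enorm => i; rewrite !mxE (le_trans (ler_norm_sum _ _ _))//.
apply: ler_sum => j _; rewrite normrM !mxE ler_wpM2l//.
rewrite (le_trans _ y1)// -sqrtr_sqr ler_wsqrtr// (bigD1 j)//= lerDl.
by rewrite sumr_ge0// => k _; exact: sqr_ge0.
Qed.

Lemma spectral_norm_ge0 m n (M : 'M[R]_(m, n)) : 0 <= spectral_norm M.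
Proof.
apply: ub_le_sup; first exact: spectral_norm_has_ubound.
by exists 0; rewrite /= ?mulmx0 enorm0.
Qed.

(** The normalization of [x] is one of the points over which the supremum is
    taken. *)
Lemma enorm_mulmx_le m n (M : 'M[R]_(m, n)) (x : 'cV[R]_n) :
  enorm (M *m x) <= spectral_norm M * enorm x.
Proof.
have [/enorm_eq0 ->|x0] := eqVneq (enorm x) 0.
  by rewrite mulmx0 !enorm0 mulr0.
have x_gt0 : 0 < enorm x by rewrite lt_neqAle eq_sym x0 enorm_ge0.
rewrite -ler_pdivrMr// mulrC -[(enorm x)^-1]gtr0_norm ?invr_gt0// -enormZ.
rewrite scalemxAr; apply: ub_le_sup; first exact: spectral_norm_has_ubound.
exists ((enorm x)^-1 *: x) => //=.
by rewrite enormZ gtr0_norm ?invr_gt0// mulVf.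
Qed.

Lemma enorm_cube_le n (x : 'cV[R]_n) :
  (forall i, -1 <= x i 0 <= 1) -> enorm x <= Num.sqrt n%:R.
Proof.
move=> x1; have -> : Num.sqrt n%:R = enorm (const_mx 1 : 'cV[R]_n).
  rewrite /enorm; congr Num.sqrt.
  under eq_bigr do rewrite mxE expr1n.
  by rewrite sumr_const card_ord.
by apply: ler_enorm => i; rewrite mxE ler_norml.
Qed.

End EuclideanNorm.

(** * Zonotopes and interval matrices *)

Section Zonotopes.
Local Open Scope classical_set_scope.
Local Open Scope ring_scope.
Context (R : realType).

Definition in_cube n (a : 'cV[R]_n) := forall i, -1 <= a i 0 <= 1.

Lemma in_cube_col_mx m n (a : 'cV[R]_m) (b : 'cV[R]_n) :
  in_cube (col_mx a b) <-> in_cube a /\ in_cube b.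
Proof.
split=> [ab|[ha hb] i].
  by split=> i; [have := ab (lshift n i)|have := ab (rshift m i)];
    rewrite (col_mxEu, col_mxEd).
by case: (split_ordP i) => j ->; rewrite (col_mxEu, col_mxEd).
Qed.

Lemma zsetP n g (Z : zonotope R n g) x :
  zset Z x <-> exists2 a, in_cube a & x = zcenter Z + zgen Z *m a.
Proof.
have sumE (a : 'I_g -> R) :
    \sum_(i < g) a i *: col i (zgen Z) = zgen Z *m \col_i a i.
  apply/colP => k; rewrite summxE mxE; apply: eq_bigr => i _.
  by rewrite !mxE mulrC.
split=> [[a a1 <-]|[a a1 ->]].
  by exists (\col_i a i); [move=> i; rewrite mxE|rewrite sumE].
exists (fun i => a i 0) => //; rewrite sumE; congr (_ + _ *m _).
by apply/colP => i; rewrite mxE.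
Qed.

Definition zbound n g (Z : zonotope R n g) : 'cV[R]_n :=
  absmx (zcenter Z) + \sum_(j < g) absmx (col j (zgen Z)).

Lemma zset_bound n g (Z : zonotope R n g) x i :
  zset Z x -> `|x i 0| <= zbound Z i 0.
Proof.
move=> /zsetP[a a1 ->]; rewrite /zbound !mxE summxE.
rewrite (le_trans (ler_normD _ _))// lerD2l (le_trans (ler_norm_sum _ _ _))//.
apply: ler_sum => j _; rewrite !mxE normrM ler_piMr//.
by rewrite ler_norml a1.
Qed.

Lemma minkowski_sum_zset_bounded n g1 g2
    (Z1 : zonotope R n g1) (Z2 : zonotope R n g2) :
  minkowski_sum (zset Z1) (zset Z2) `<=`
    axis_box (- (zbound Z1 + zbound Z2)) (zbound Z1 + zbound Z2).
Proof.
move=> _ [x Zx [y Zy <-]] i; rewrite [X in X <= _]mxE -ler_norml mxE [leRHS]mxE.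
by rewrite (le_trans (ler_normD _ _))// lerD// zset_bound.
Qed.

(** The first generator of [comb] interpolates the centers; the deviation of
    the point from the segment joining the points of [Z1] and [Z2] with common
    coefficients [a] only involves the difference of the generators. *)
Lemma comb_point n g (Z1 Z2 : zonotope R n g) (r : R) (a b : 'cV[R]_g) :
  zcenter (comb Z1 Z2) +
    zgen (comb Z1 Z2) *m col_mx (col_mx (const_mx (1 - 2 * r)) a) b =
  (1 - r) *: (zcenter Z1 + zgen Z1 *m a) + r *: (zcenter Z2 + zgen Z2 *m a) +
    (zgen Z2 - zgen Z1) *m (2^-1 *: (a - b) - r *: a).
Proof.
rewrite /= !mul_row_col.
have -> : (const_mx (1 - 2 * r) : 'cV[R]_1) = (1 - 2 * r)%:M.
  by apply/matrixP => i j; rewrite !ord1 !mxE mulr1n.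
rewrite mul_mx_scalar -!scalemxAl mulmxBr -!scalemxAr mulmxBr !mulmxBl !mulmxDl.
move: (zgen Z1 *m a) (zgen Z1 *m b) (zgen Z2 *m a) (zgen Z2 *m b).
by move=> x1 y1 x2 y2; apply/colP => i; rewrite !mxE; field.
Qed.

End Zonotopes.

Section IntervalMatrices.
Local Open Scope classical_set_scope.
Local Open Scope ring_scope.
Context (R : realType) (n : nat).
Implicit Types (I J : imatrix R n) (M N : 'M[R]_n).

Definition imatrix_mem I M := forall i j, I.1 i j <= M i j <= I.2 i j.

Lemma imatrix_memD I J M N :
  imatrix_mem I M -> imatrix_mem J N -> imatrix_mem (I + J) (M + N).
Proof.
move=> IM JN i j; rewrite !mxE !lerD//.
all: by case/andP: (IM i j) (JN i j) => ? ? /andP[].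
Qed.

Lemma imatrix_mem_sum (T : eqType) (r : seq T)
    (I : T -> imatrix R n) (M : T -> 'M[R]_n) :
  (forall t, t \in r -> imatrix_mem (I t) (M t)) ->
  imatrix_mem (\sum_(t <- r) I t) (\sum_(t <- r) M t).
Proof.
move=> IM; rewrite big_seq [X in imatrix_mem _ X]big_seq.
elim/big_ind2 : _ => [i j||]//; first by rewrite !mxE lexx.
by move=> *; exact: imatrix_memD.
Qed.

Lemma imatrix_mem_scale (a : R * R) (c : R) M :
  a.1 <= c <= a.2 -> imatrix_mem (interval_scale_mx a M) (c *: M).
Proof.
move=> /andP[ac ca] i j; rewrite !mxE ge_min le_max.
have [M0|/ltW M0] := leP 0 (M i j).
  by rewrite (ler_wpM2r M0 ac) (ler_wpM2r M0 ca) orbT.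
by rewrite (ler_wnM2r M0 ac) (ler_wnM2r M0 ca) orbT.
Qed.

(** The center of the interval matrix acts linearly on the zonotope; what is
    left is bounded entrywise, hence lies in the box spanned by the diagonal
    generators. *)
Lemma imatrix_zonotope_mem g I M (Z : zonotope R n g) x :
  imatrix_mem I M -> zset Z x -> zset (imatrix_zonotope I Z) (M *m x).
Proof.
move=> IM Zx; have xb i := zset_bound i Zx.
have [a a1 xE] := (zsetP _ _).1 Zx.
set rho := imatrix_radius I *m zbound Z.
set rest := (M - imatrix_center I) *m x.
have rest_le i : `|rest i 0| <= rho i 0.
  rewrite !mxE (le_trans (ler_norm_sum _ _ _))//; apply: ler_sum => j _.
  rewrite normrM; apply: ler_pM => //.
  rewrite !mxE ler_norml; have /andP[] := IM i j; lra.
apply/zsetP; exists (col_mx a (\col_i (rest i 0 / rho i 0))).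
  apply/in_cube_col_mx; split=> // i; rewrite mxE -ler_norml normf_div.
  (* where [rho] vanishes so does [rest], and the coefficient is x / 0 = 0 *)
  have [r0|r0] := eqVneq (rho i 0) 0; first by rewrite r0 normr0 invr0 mulr0.
  rewrite ler_pdivrMr ?normr_gt0// mul1r.
  exact: le_trans (rest_le i) (ler_norm _).
rewrite /= mul_row_col addrA -mulmxA -mulmxDr -xE mul_diag_mx.
suff -> : \matrix_(i, j) (rho^T 0 i * (\col_k (rest k 0 / rho k 0)) i j) = rest.
  by rewrite /rest mulmxBl addrC subrK.
apply/colP => i; rewrite 2!mxE [in LHS]mxE.
have [r0|r0] := eqVneq (rho i 0) 0; last by rewrite mulrC divfK.
by have := rest_le i; rewrite r0 normr_le0 mul0r => /eqP ->.
Qed.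

End IntervalMatrices.

(** * Matrix power series *)

Section MatrixSeries.
Local Open Scope classical_set_scope.
Local Open Scope ring_scope.
Context (R : realType).

(** Neighbourhoods of a matrix are generated by boxes of neighbourhoods of its
    entries, and there are finitely many entries. *)
Lemma cvg_mxP m n (T : Type) (F : set_system T) {FF : Filter F}
    (f : T -> 'M[R]_(m, n)) (L : 'M[R]_(m, n)) :
  f @ F --> L <-> forall i j, (fun t => f t i j) @ F --> L i j.
Proof.
split=> [fL i j|fL].
  exact: (cvg_comp _ _ fL (@coord_continuous R m n i j L)).
move=> A [P LP PA].
have : \forall t \near F, forall i j, P i j (f t i j).
  by apply: filter_forall => i; apply: filter_forall => j; exact/fL/LP.
by apply: filterS => t Pt; exact: PA.
Qed.

Lemma seriesmxE m n (f : nat -> 'M[R]_(m, n)) i j N :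
  series f N i j = series (fun k => f k i j) N.
Proof. by rewrite /series/= summxE. Qed.

Lemma cvg_seriesmxP m n (f : nat -> 'M[R]_(m, n)) (L : 'M[R]_(m, n)) :
  series f @ \oo --> L <->
  forall i j, series (fun k => f k i j) @ \oo --> L i j.
Proof.
rewrite cvg_mxP; split=> fL i j; have := fL i j;
  by rewrite (_ : (fun t => series f t i j) = series (fun k => f k i j))//;
     apply/funext => N; rewrite seriesmxE.
Qed.

Lemma is_cvg_seriesmx m n (f : nat -> 'M[R]_(m, n)) :
  (forall i j, cvgn (series (fun k => f k i j))) -> cvgn (series f).
Proof.
move=> fc; apply/cvg_ex.
exists (\matrix_(i, j) limn (series (fun k => f k i j))).
by apply/cvg_seriesmxP => i j; rewrite mxE; exact: fc.
Qed.

(** Both remainders are limits of the sums over [m <= k < N], which are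
    compared term by term. *)
Lemma series_remainder_le (u v : nat -> R) (U V : R) (m : nat) :
  series u @ \oo --> U -> series v @ \oo --> V ->
  (forall k, (m <= k)%N -> `|u k| <= v k) ->
  `|U - \sum_(0 <= k < m) u k| <= V - \sum_(0 <= k < m) v k.
Proof.
move=> uU vV uv.
have uU' : (fun N => `|series u N - \sum_(0 <= k < m) u k|) @ \oo -->
    `|U - \sum_(0 <= k < m) u k|.
  by apply: cvg_norm; apply: cvgB => //; exact: cvg_cst.
have vV' : (fun N => series v N - \sum_(0 <= k < m) v k) @ \oo -->
    V - \sum_(0 <= k < m) v k.
  by apply: cvgB => //; exact: cvg_cst.
apply: (ler_cvg_to uU' vV').
near=> N; have mN : (m <= N)%N by near: N; exact: nbhs_infty_ge.
rewrite /series/= !(big_cat_nat (leq0n m) mN)/= ![_ + _ - _]addrAC !subrr !add0r.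
rewrite (le_trans (ler_norm_sum _ _ _))//.
apply: ler_sum_nat => k /andP[mk _]; exact: uv.
Unshelve. all: by end_near. Qed.

Lemma seriesmx_remainder_le p q (f g : nat -> 'M[R]_(p, q))
    (F G : 'M[R]_(p, q)) (m : nat) i j :
  series f @ \oo --> F -> series g @ \oo --> G ->
  (forall k, (m <= k)%N -> `|f k i j| <= g k i j) ->
  `|(F - \sum_(0 <= k < m) f k) i j| <= (G - \sum_(0 <= k < m) g k) i j.
Proof.
move=> /cvg_seriesmxP fF /cvg_seriesmxP gG fg.
by rewrite !mxE !summxE; exact: series_remainder_le.
Qed.

End MatrixSeries.

Section MatrixExponential.
Local Open Scope classical_set_scope.
Local Open Scope ring_scope.
Context (R : realType) (n : nat).
Implicit Types A : 'M[R]_n.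

Lemma exprZmx A (s : R) i : (s *: A) ^+ i = s ^+ i *: A ^+ i.
Proof.
elim: i => [|i IH]; first by rewrite !expr0 scale1r.
by rewrite !exprS IH /GRing.mul/= -scalemxAl -scalemxAr scalerA.
Qed.

Lemma normr_exprmx_le A i k l : `|(A ^+ i) k l| <= (absmx A ^+ i) k l.
Proof.
elim: i k l => [|i IH] k l.
  by rewrite !expr0 !mxE; case: eqP; rewrite ?normr1 ?normr0.
rewrite !exprS !mxE (le_trans (ler_norm_sum _ _ _))//.
by apply: ler_sum => h _; rewrite normrM ler_pM// mxE.
Qed.

Definition entry_sum A : R := \sum_i \sum_j `|A i j|.

Lemma entry_sum_ge0 A : 0 <= entry_sum A.
Proof. by rewrite sumr_ge0// => i _; rewrite sumr_ge0. Qed.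

Lemma normr_exprmx_le_entry_sum A i k l : `|(A ^+ i) k l| <= entry_sum A ^+ i.
Proof.
elim: i k l => [|i IH] k l.
  by rewrite !expr0 !mxE; case: eqP => _; rewrite ?normr1// normr0.
rewrite !exprS mxE (le_trans (ler_norm_sum _ _ _))//.
under eq_bigr do rewrite normrM.
apply: (@le_trans _ _ (\sum_j `|A k j| * entry_sum A ^+ i)).
  by apply: ler_sum => j _; rewrite ler_wpM2l.
rewrite -mulr_suml ler_wpM2r ?exprn_ge0 ?entry_sum_ge0//.
rewrite [leRHS](bigD1 k)//= lerDl sumr_ge0// => i' _.
exact: sumr_ge0.
Qed.

(** The entries of [A ^+ i] are at most [entry_sum A ^+ i], so each entry of the
    series is dominated by the real series of [K * exp (r * entry_sum A)]. *)
Lemma is_cvg_mxpower_series A (c : nat -> R) (K r : R) :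
  0 <= K -> 0 <= r -> (forall i, `|c i| <= K * (r ^+ i / i`!%:R)) ->
  cvgn (series (fun i => c i *: A ^+ i)).
Proof.
move=> K0 r0 cK; apply: is_cvg_seriesmx => k l.
apply: normed_cvg; set s := r * entry_sum A.
have s0 : 0 <= s by rewrite mulr_ge0// entry_sum_ge0.
apply: (@series_le_cvg _ _ (fun i => K * exp_coeff s i)).
- by move=> i; exact: normr_ge0.
- by move=> i; rewrite mulr_ge0// /exp_coeff/= divr_ge0// exprn_ge0.
- move=> i /=; rewrite mxE normrM /exp_coeff/= /s exprMn.
  rewrite (_ : K * _ = K * (r ^+ i / i`!%:R) * entry_sum A ^+ i); last by ring.
  by rewrite ler_pM// normr_exprmx_le_entry_sum.
- exact: (is_cvg_seriesZ (is_cvg_series_exp_coeff s)).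
Qed.

Lemma cvg_expmx A (s : R) :
  series (fun i => s ^+ i *: (i`!%:R^-1 *: A ^+ i)) @ \oo --> expmx (s *: A).
Proof.
set f := (X in series X).
have fE : f = fun i => (s ^+ i / i`!%:R) *: A ^+ i.
  by apply/funext => i; rewrite /f scalerA.
have expE : (fun i => i`!%:R^-1 *: (s *: A) ^+ i) = f.
  by apply/funext => i; rewrite exprZmx scalerA mulrC -scalerA.
rewrite /expmx expE fE.
apply: (is_cvg_mxpower_series (K := 1) (r := `|s|)) => // i.
by rewrite mul1r normrM normfV normrX [`|_%:R|]ger0_norm.
Qed.

Lemma cvg_mulmx m p q (T : Type) (F : set_system T) {FF : Filter F}
    (M : 'M[R]_(m, p)) (f : T -> 'M[R]_(p, q)) (L : 'M[R]_(p, q)) :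
  f @ F --> L -> (fun t => M *m f t) @ F --> M *m L.
Proof.
move=> /cvg_mxP fL; apply/cvg_mxP => i j.
rewrite (_ : (fun _ => _) = (fun t => \sum_k M i k * f t k j)); last first.
  by apply/funext => t; rewrite mxE.
rewrite mxE; apply: cvg_big; first exact: add_continuous.
by move=> k _; apply: cvgM => //; exact: cvg_cst.
Qed.

(** For invertible [A] the two readings of [A^-1 (e^{As} - I)] agree:
    multiplying the partial sums of the series by [A] gives those of the
    exponential without their first term. *)
Lemma cvg_inv_expmx A (s : R) :
  series (fun i => s ^+ i.+1 *: (i.+1`!%:R^-1 *: A ^+ i)) @ \oo
    --> inv_expmx A s.
Proof.
set f := (X in series X).
have fE : f = fun i => (s ^+ i.+1 / i.+1`!%:R) *: A ^+ i.
  by apply/funext => i; rewrite /f scalerA.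
have fcvg : cvgn (series f).
  rewrite fE; apply: (is_cvg_mxpower_series (K := `|s|) (r := `|s|)) => // i.
  rewrite normrM normfV normrX [`|_%:R|]ger0_norm// exprS -mulrA.
  rewrite ler_wpM2l// ler_wpM2l ?exprn_ge0// lef_pV2 ?posrE ?ltr0n ?fact_gt0//.
  by rewrite ler_nat factS leq_pmull.
rewrite /inv_expmx -fE; case: ifPn => // Aunit.
suff -> : expmx (s *: A) - 1%:M = A *m limn (series f) by rewrite mulKmx.
have Af N : A *m series f N =
    series (fun i => s ^+ i *: (i`!%:R^-1 *: A ^+ i)) N.+1 - 1%:M.
  rewrite /series/= big_nat_recl// expr0 fact0 invr1 !scale1r expr0 addrAC subrr.
  rewrite add0r mulmx_sumr; apply: eq_bigr => i _.
  by rewrite -!scalemxAr [A ^+ i.+1]exprS.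
have AfL : (fun N => A *m series f N) @ \oo --> A *m limn (series f).
  exact: cvg_mulmx.
rewrite (funext Af) in AfL.
apply: (cvg_unique (@norm_hausdorff _ _) _ AfL).
apply: cvgB; last exact: cvg_cst.
by rewrite (cvg_shiftS (series _)); exact: cvg_expmx.
Qed.

End MatrixExponential.

(** * The curvature defect of the chord *)

Section InterpolationDefect.
Local Open Scope classical_set_scope.
Local Open Scope ring_scope.
Context (R : realType).

(** A convex power lies above its tangent at [a]: multiplying the inequality
    for one exponent by [x] gives the next one up to a multiple of
    [(x - a)^2]. *)
Lemma pow_tangent_le (a x : R) i :
  0 <= a -> 0 <= x -> a ^+ i.+1 + i.+1%:R * a ^+ i * (x - a) <= x ^+ i.+1.
Proof.
move=> a0 x0; elim: i => [|i IH]; first by rewrite !expr1 expr0; lra.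
apply: le_trans (_ : x * (a ^+ i.+1 + i.+1%:R * a ^+ i * (x - a)) <= _); last first.
  by rewrite [leRHS]exprS ler_wpM2l.
rewrite -subr_ge0 [X in 0 <= X](_ : _ = i.+1%:R * a ^+ i * (x - a) ^+ 2).
  by rewrite mulr_ge0 ?sqr_ge0// mulr_ge0// exprn_ge0.
by rewrite !exprS -[i.+2%:R]natr1; ring.
Qed.

(** On [0, 1] the function [l^i - l] is nonpositive and convex, with minimum at
    the point [a = i^(-1/(i-1))] where [i * a^(i-1) = 1]; the tangent there is
    horizontal, and [a^i - a] is the left end of the interval. *)
Lemma interval_I_bound i (dt l : R) : (1 < i)%N -> 0 <= dt -> 0 <= l <= 1 ->
  (interval_I i dt).1 <= (l ^+ i - l) * dt ^+ i <= (interval_I i dt).2.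
Proof.
case: i => [//|[//|i]] _ dt0 /andP[l0 l1]; set k := i.+2.
have dtk : 0 <= dt ^+ k by rewrite exprn_ge0.
apply/andP; split; last first.
  by rewrite /= mulr_le0_ge0// subr_le0 exprS ler_piMr// exprn_ile1.
rewrite /= ler_wpM2r//.
have kE : (k%:R : R) - 1 = i.+1%:R by rewrite /k -[i.+2%:R]natr1 addrK.
rewrite kE; set a := _ `^ (- (1 / _)).
have a0 : 0 <= a by exact: powR_ge0.
have -> : k%:R `^ (- (k%:R / i.+1%:R)) = a ^+ k.
  by rewrite -powR_mulrn// -powRrM; congr (_ `^ _); ring.
have ka : k%:R * a ^+ i.+1 = 1.
  rewrite -powR_mulrn// -powRrM mulNr div1r mulVf ?pnatr_eq0// powR_inv1//.
  by rewrite divff// pnatr_eq0.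
by have := pow_tangent_le i.+1 a0 l0; rewrite ka -/k; lra.
Qed.

Lemma normr_pow_sub_le1 (l : R) i : 0 <= l <= 1 -> `|l ^+ i - l| <= 1.
Proof.
move=> /andP[l0 l1]; have := exprn_ge0 i l0; have := exprn_ile1 i l0 l1.
by rewrite ler_norml; lra.
Qed.

Context (n : nat) (A : 'M[R]_n) (dt : R) (dt_ge0 : 0 <= dt).

(** Chord interpolation acts on a power series in the time by replacing the
    coefficient [l^i] with [l^i - l]. *)
Lemma cvg_expmx_interp l :
  series (fun i => ((l ^+ i - l) * dt ^+ i) *: (i`!%:R^-1 *: A ^+ i)) @ \oo -->
  expmx ((l * dt) *: A) - l *: expmx (dt *: A).
Proof.
rewrite (_ : series _ =
    (fun N => series (fun i => (l * dt) ^+ i *: (i`!%:R^-1 *: A ^+ i)) N -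
      l *: series (fun i => dt ^+ i *: (i`!%:R^-1 *: A ^+ i)) N)).
  by apply: cvgB; [exact: cvg_expmx|apply: cvgZl_tmp; exact: cvg_expmx].
apply/funext => N; rewrite /series/= scaler_sumr -sumrB.
by apply: eq_bigr => i _; rewrite exprMn [l *: (_ *: _)]scalerA -scalerBl mulrBl.
Qed.

Lemma cvg_inv_expmx_interp l :
  series (fun i => ((l ^+ i.+1 - l) * dt ^+ i.+1) *: (i.+1`!%:R^-1 *: A ^+ i))
    @ \oo --> inv_expmx A (l * dt) - l *: inv_expmx A dt.
Proof.
rewrite (_ : series _ =
    (fun N => series (fun i => (l * dt) ^+ i.+1 *: (i.+1`!%:R^-1 *: A ^+ i)) N -
      l *: series (fun i => dt ^+ i.+1 *: (i.+1`!%:R^-1 *: A ^+ i)) N)).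
  by apply: cvgB; [exact: cvg_inv_expmx|apply: cvgZl_tmp; exact: cvg_inv_expmx].
apply/funext => N; rewrite /series/= scaler_sumr -sumrB.
by apply: eq_bigr => i _; rewrite exprMn [l *: (_ *: _)]scalerA -scalerBl mulrBl.
Qed.

(** Entrywise [|A^k| <= |A|^k], so the tail is dominated by that of
    [K * e^{|A| dt}]. The factor [K] is 1 for the interval matrix [F] and [dt]
    for [G]. *)
Lemma series_tail_le_rem_bound (f : nat -> 'M[R]_n) (L : 'M[R]_n) (K : R) eta :
  0 <= K -> series f @ \oo --> L ->
  (forall k i j, (eta < k)%N ->
    `|f k i j| <= K * (dt ^+ k * (k`!%:R^-1 * `|(A ^+ k) i j|))) ->
  forall i j, `|(L - \sum_(0 <= k < eta.+1) f k) i j| <=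
    K * rem_bound A dt eta i j.
Proof.
move=> K0 fL fK i j.
pose g k := K *: (k`!%:R^-1 *: (dt *: absmx A) ^+ k).
have gL : series g @ \oo --> K *: expmx (dt *: absmx A).
  rewrite (_ : series g = fun N =>
      K *: series (fun k => dt ^+ k *: (k`!%:R^-1 *: absmx A ^+ k)) N).
    by apply: cvgZl_tmp; exact: cvg_expmx.
  apply/funext => N; rewrite /series/= scaler_sumr; apply: eq_bigr => k _.
  by rewrite /g exprZmx; congr (_ *: _); rewrite !scalerA mulrC.
have -> : K * rem_bound A dt eta i j =
    (K *: expmx (dt *: absmx A) - \sum_(0 <= k < eta.+1) g k) i j.
  by rewrite /g -scaler_sumr -scalerBr [RHS]mxE.
apply: seriesmx_remainder_le => // k etak; rewrite (le_trans (fK _ _ _ etak))//.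
rewrite /g exprZmx !mxE ler_wpM2l// mulrCA ler_wpM2l ?invr_ge0//.
by rewrite ler_wpM2l ?exprn_ge0// normr_exprmx_le.
Qed.

(** The terms of index 2 to [eta] lie in the scaled intervals, and the tail is
    absorbed by the remainder interval. *)
Lemma expmx_interp_mem eta l : (0 < eta)%N -> 0 <= l <= 1 ->
  imatrix_mem (imatrix_F A dt eta)
    (expmx ((l * dt) *: A) - 1%:M - l *: (expmx (dt *: A) - 1%:M)).
Proof.
move=> eta0 l01.
pose f i := ((l ^+ i - l) * dt ^+ i) *: (i`!%:R^-1 *: A ^+ i).
set L := expmx ((l * dt) *: A) - l *: expmx (dt *: A).
have tail i j : `|(L - \sum_(0 <= k < eta.+1) f k) i j| <= rem_bound A dt eta i j.
  rewrite -[leRHS]mul1r; apply: series_tail_le_rem_bound => //.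
    exact: cvg_expmx_interp.
  move=> k p q _; rewrite /f !mxE !normrM normfV [`|dt ^+ _|]ger0_norm ?exprn_ge0//.
  rewrite [`|_%:R|]ger0_norm// -mulrA; apply: ler_wpM2r.
    by rewrite mulr_ge0 ?exprn_ge0// mulr_ge0// invr_ge0.
  exact: normr_pow_sub_le1.
(* the term of index 0 accounts for the two identity matrices, and the term of
   index 1 vanishes *)
have head : \sum_(0 <= k < eta.+1) f k =
    (1 - l)%:M + \sum_(2 <= k < eta.+1) f k.
  rewrite big_ltn// big_ltn// {1 2}/f !expr1 subrr mul0r scale0r add0r.
  by rewrite !expr0 fact0 invr1 mulr1 scale1r scalemx1.
rewrite (_ : _ - _ = \sum_(2 <= i < eta.+1) f i +
    (L - \sum_(0 <= k < eta.+1) f k)).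
  apply: imatrix_memD => [|i j]; last by rewrite /= [X in X <= _]mxE -ler_norml.
  apply: imatrix_mem_sum => i; rewrite mem_index_iota => /andP[i2 _].
  by apply: imatrix_mem_scale; exact: interval_I_bound.
rewrite head [RHS]addrC opprD addrA addrNK /L.
move: (expmx _) (expmx _) => X Y; apply/matrixP => i j; rewrite !mxE.
by case: (i == j); rewrite ?mulr1n ?mulr0n; ring.
Qed.

(** The coefficient of [A^k] has [l^(k+1) - l], controlled by the interval
    [I_(k+1)]; the inequality [1 / (k+1)! <= 1 / k!] compares the tail with [dt]
    times that of [e^{|A| dt}]. *)
Lemma inv_expmx_interp_mem eta l : 0 <= l <= 1 ->
  imatrix_mem (imatrix_G A dt eta) (inv_expmx A (l * dt) - l *: inv_expmx A dt).
Proof.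
move=> l01.
pose f i := ((l ^+ i.+1 - l) * dt ^+ i.+1) *: (i.+1`!%:R^-1 *: A ^+ i).
set L := _ - _.
have tail i j : `|(L - \sum_(0 <= k < eta.+1) f k) i j| <=
    dt * rem_bound A dt eta i j.
  apply: series_tail_le_rem_bound => //; first exact: cvg_inv_expmx_interp.
  move=> k p q _; rewrite /f !mxE !normrM normfV.
  rewrite [`|dt ^+ _|]ger0_norm ?exprn_ge0// [`|_%:R|]ger0_norm//.
  rewrite [dt ^+ _]exprS -!mulrA -[leRHS]mul1r; apply: ler_pM => //.
  - by rewrite !mulr_ge0 ?exprn_ge0// invr_ge0.
  - exact: normr_pow_sub_le1.
  - rewrite ler_wpM2l// ler_wpM2l ?exprn_ge0// ler_wpM2r//.
    rewrite lef_pV2 ?posrE ?ltr0n ?fact_gt0//.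
    by rewrite ler_nat factS leq_pmull.
rewrite (_ : L = \sum_(2 <= i < eta.+2) f i.-1 +
    (L - \sum_(0 <= k < eta.+1) f k)).
  apply: imatrix_memD => [|i j].
    apply: imatrix_mem_sum => -[|i]; rewrite mem_index_iota// => /andP[i2 _].
    by apply: imatrix_mem_scale; exact: interval_I_bound.
  have := tail i j; rewrite ler_norml => /andP[lo hi].
  apply/andP; split.
    by rewrite [leLHS]mxE ge_min /= [X in X * dt]mxE mulNr [_ * dt]mulrC lo.
  by rewrite [leRHS]mxE le_max /= [rem_bound _ _ _ _ _ * dt]mulrC hi orbT.
have -> : \sum_(0 <= k < eta.+1) f k = \sum_(2 <= i < eta.+2) f i.-1.
  rewrite big_ltn// {1}/f expr1 subrr mul0r scale0r add0r.
  by rewrite [RHS]big_add1.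
by rewrite addrC subrK.
Qed.

End InterpolationDefect.

(** * The two inclusions up to the error bound *)

Section Reachability.
Local Open Scope classical_set_scope.
Local Open Scope ring_scope.
Context (R : realType) (n g : nat) (A : 'M[R]_n) (u : 'cV[R]_n).
Implicit Types H : zonotope R n g.

Definition affine_flow (s : R) (x : 'cV[R]_n) : 'cV[R]_n :=
  expmx (s *: A) *m x + inv_expmx A s *m u.

(** The defect is linear in [x] and [u], and each of its two matrices belongs to
    the interval matrix that defines the corresponding summand of [C]. *)
Lemma flow_defect_curvature (dt l : R) eta H x :
  0 <= dt -> (0 < eta)%N -> 0 <= l <= 1 -> zset H x ->
  curvature A u dt eta H
    (affine_flow (l * dt) x - ((1 - l) *: x + l *: affine_flow dt x)).
Proof.
move=> dt0 eta0 l01 Hx.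
exists ((expmx ((l * dt) *: A) - 1%:M - l *: (expmx (dt *: A) - 1%:M)) *m x).
  exact: imatrix_zonotope_mem (expmx_interp_mem A dt0 eta0 l01) Hx.
exists ((inv_expmx A (l * dt) - l *: inv_expmx A dt) *m u).
  apply: imatrix_zonotope_mem (inv_expmx_interp_mem A dt0 eta l01) _.
  by apply/zsetP; exists 0 => [[]//|]; rewrite /= mul0mx addr0.
rewrite /affine_flow !mulmxBl -!scalemxAl mulmxBl mul1mx.
move: (expmx _ *m x) (inv_expmx _ _ *m u) (expmx _ *m x) (inv_expmx _ _ *m u).
by move=> e1 p1 e2 p2; apply/colP => i; rewrite !mxE; ring.
Qed.

Lemma exact_solutionP (tk dt : R) H x : 0 < dt ->
  exact_solution A u tk (tk + dt) H x <->
  exists2 l, 0 <= l <= 1 & exists2 x0, zset H x0 & x = affine_flow (l * dt) x0.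
Proof.
move=> dt0; split.
  move=> [t]; rewrite /= in_itv/= => /andP[t0 t1] [x0 Hx0 <-].
  exists ((t - tk) / dt); last by exists x0 => //; rewrite divfK// gt_eqF.
  by rewrite ler_pdivrMr// mul1r divr_ge0 ?subr_ge0 ?(ltW dt0)//=; lra.
move=> [l /andP[l0 l1] [x0 Hx0 ->]]; exists (tk + l * dt); last first.
  by exists x0 => //; rewrite addrAC subrr add0r.
by rewrite /= in_itv/= lerDl lerD2l mulr_ge0 ?(ltW dt0)//= ler_piMl ?(ltW dt0).
Qed.

Lemma next_step_point (dt : R) H (a : 'cV[R]_g) :
  zcenter (next_step A u dt H) + zgen (next_step A u dt H) *m a =
  affine_flow dt (zcenter H + zgen H *m a).
Proof. by rewrite /= /affine_flow mulmxDr mulmxA addrAC. Qed.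

(** The same [a] serves for the exact point and for the point of [comb]; with
    [b] = [(1 - 2 l) a] the latter is the chord point of the trajectory. *)
Lemma exact_solution_sub_outer (tk dt : R) eta H : 0 < dt -> (0 < eta)%N ->
  exact_solution A u tk (tk + dt) H `<=` outer_approx A u dt eta H.
Proof.
move=> dt0 eta0 x /(exact_solutionP _ _ _ dt0)[l l01 [x0 Hx0 ->]].
have /zsetP[a a1 x0E] := Hx0.
exists ((1 - l) *: x0 + l *: affine_flow dt x0); last first.
  exists (affine_flow (l * dt) x0 - ((1 - l) *: x0 + l *: affine_flow dt x0)).
    exact: flow_defect_curvature (ltW dt0) eta0 l01 Hx0.
  by rewrite addrC subrK.
have r1 : -1 <= 1 - 2 * l <= 1 by lra.
apply/zsetP.
exists (col_mx (col_mx (const_mx (1 - 2 * l)) a) ((1 - 2 * l) *: a)).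
  apply/in_cube_col_mx; split=> [|i].
    by apply/in_cube_col_mx; split=> // i; rewrite mxE.
  rewrite mxE -ler_norml normrM mulr_ile1// ler_norml//; exact: a1.
rewrite comb_point next_step_point -x0E.
rewrite (_ : _ *: _ - _ = 0) ?mulmx0 ?addr0//.
by apply/colP => i; rewrite !mxE; field.
Qed.

(** Both points deviate from the chord point with the same coefficients: the
    exact one by a curvature vector, the other one by a curvature vector and a
    combination of the columns of [(e^{A dt} - I) G] by a vector of the cube. *)
Lemma outer_near_exact_solution (tk dt : R) eta H y : 0 < dt -> (0 < eta)%N ->
  outer_approx A u dt eta H y ->
  exists2 x, exact_solution A u tk (tk + dt) H x &
    enorm (x - y) <= error_bound A u dt eta H.
Proof.
move=> dt0 eta0 [p /zsetP[w w1 pE] [c Cc <-]].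
have wE : w = col_mx (col_mx (usubmx (usubmx w)) (dsubmx (usubmx w))) (dsubmx w).
  by rewrite !vsubmxK.
move: wE w1 pE.
move: (usubmx (usubmx w)) (dsubmx (usubmx w)) (dsubmx w) => v a b ->.
move=> /in_cube_col_mx[/in_cube_col_mx[v1 a1] b1].
pose l := (1 - v 0 0) / 2.
have -> : v = const_mx (1 - 2 * l).
  by apply/colP => i; rewrite ord1 mxE /l; field.
have l01 : 0 <= l <= 1 by have := v1 0; rewrite /l; lra.
set x0 := zcenter H + zgen H *m a.
have Hx0 : zset H x0 by apply/zsetP; exists a.
rewrite comb_point next_step_point -/x0 => ->.
exists (affine_flow (l * dt) x0).
  by apply/exact_solutionP => //; exists l => //; exists x0.
have Ce := flow_defect_curvature (ltW dt0) eta0 l01 Hx0.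
set e := _ - (_ + _) in Ce.
have err_ge d : curvature A u dt eta H d ->
    enorm d <= err (curvature A u dt eta H).
  exact/enorm_le_err/minkowski_sum_zset_bounded.
pose d := l *: a - 2^-1 *: (a - b).
have d1 : in_cube d.
  by move=> i; have := a1 i; have := b1 i; rewrite !mxE; nra.
have -> : zgen (next_step A u dt H) - zgen H =
    (expmx (dt *: A) - 1%:M) *m zgen H by rewrite mulmxBl mul1mx.
set G := _ *m zgen H.
have -> : affine_flow (l * dt) x0 - ((1 - l) *: x0 + l *: affine_flow dt x0 +
    G *m (2^-1 *: (a - b) - l *: a) + c) = e - c + G *m d.
  have -> : 2^-1 *: (a - b) - l *: a = - d by rewrite /d opprB.
  rewrite mulmxN /e.
  move: (affine_flow _ _) (_ *: x0 + _) (G *m d) => x1 x2 z.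
  by apply/colP => i; rewrite !mxE; ring.
rewrite /error_bound (le_trans (ler_enormD _ _))// lerD//.
  rewrite (le_trans (ler_enormD _ _))// enormN.
  by rewrite mulr_natl mulr2n lerD// err_ge.
rewrite (le_trans (enorm_mulmx_le _ _))// mulrC ler_wpM2r//.
  exact: spectral_norm_ge0.
exact: enorm_cube_le.
Qed.

End Reachability.

Local Open Scope ring_scope.
Local Open Scope ereal_scope.

Theorem proposition1 (R : realType) (n gamma : nat) (A : 'M[R]_n)
    (u ch : 'cV[R]_n) (Gh : 'M[R]_(n, gamma)) (tk tk1 dt : R) (eta : nat)
    (htk : (0 <= tk)%R) (hdt : (0 < dt)%R) (htk1 : tk1 = (tk + dt)%R)
    (heta : (0 < eta)%N) :
  hausdorff_dist (exact_solution A u tk tk1 (Zonotope ch Gh))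
                 (outer_approx A u dt eta (Zonotope ch Gh))
  <= (error_bound A u dt eta (Zonotope ch Gh))%:E.
Proof.
rewrite htk1; set H := Zonotope ch Gh.
have near := @outer_near_exact_solution _ _ _ A u tk dt eta H _ hdt heta.
apply: hausdorff_dist_le => [x Ex|y]; last exact: near.
have Ox : outer_approx A u dt eta H x by exact: exact_solution_sub_outer Ex.
(* the bound is nonnegative because it bounds some distance *)
exists x => //; rewrite subrr enorm0.
by have [x' _] := near _ Ox; apply: le_trans; exact: enorm_ge0.
Qed.
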